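(* Let $A$ be a haploid commutative $\Delta$-separable special Frobenius algebra in $\mathcal{C}$. Then: (1) If $A$ is symmetric, then $\dim A=\epsilon\circ\eta\neq 0$. (2) If $A$ is not symmetric, then $\dim A=0$. Moreover, when $A$ is not symmetric, let $p_\pm=\tfrac12(\mathrm{id}_A\pm\theta_A)$ (which are idempotents), $B:=\mathrm{im}(p_+)$, $F:=\mathrm{im}(p_-)$, with inclusions $\iota_B,\iota_F$ and projections $\pi_B,\pi_F$, so that $A=B\oplus F$. Then $B$, with multiplication $\pi_B\circ\mu\circ(\iota_B\otimes\iota_B)$, unit $\pi_B\circ\eta$, comultiplication $(\pi_B\otimes\pi_B)\circ\Delta\circ\iota_B$ and counit $\epsilon\circ\iota_B$, is a haploid symmetric commutative special Frobenius algebra; $F$, with action $\pi_F\circ\mu\circ(\iota_B\otimes\iota_F):B\otimes F\to F$, is a local $B$-module with $\theta_F=-\mathrm{id}_F$; and $F\otimes_B F\cong B$.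
   Context: Standing assumptions: $k$ is a field with $\mathrm{char}(k)\neq 2$. $\mathcal{C}$ is a $k$-linear additive idempotent-complete ribbon category, strict as a monoidal category, with bilinear tensor product and absolutely simple tensor unit ($\mathrm{End}_{\mathcal{C}}(1)=k\,\mathrm{id}_1$), with braiding $c$ and twist $\theta$. Scalars in $\mathrm{End}(1)$ are identified with elements of $k$; $\dim X$ denotes the categorical (ribbon) trace of $\mathrm{id}_X$. A Frobenius algebra $(A,\mu,\eta,\Delta,\epsilon)$ is an algebra and coalgebra with $(\mathrm{id}\otimes\mu)(\Delta\otimes\mathrm{id})=\Delta\mu=(\mu\otimes\mathrm{id})(\mathrm{id}\otimes\Delta)$. It is commutative if $\mu\circ c_{A,A}=\mu$; $\Delta$-separable if $\mu\circ\Delta=\mathrm{id}_A$; special if $\epsilon\circ\eta\in k^\times\mathrm{id}_1$ and $\mu\circ\Delta\in k^\times\mathrm{id}_A$; haploid if $\dim_k\mathrm{Hom}(1,A)=1$; symmetric if its Nakayama automorphism $N_A$ is the identity, where, with $\kappa=\epsilon\circ\mu$, $N_A=\Phi_1^{-1}\circ\Phi_2$ for the isomorphisms $\Phi_1=(\kappa\otimes\mathrm{id}_{A^*})(\mathrm{id}_A\otimes\mathrm{coev}_A)$ and $\Phi_2=(\mathrm{id}_{A^*}\otimes\kappa)(\widetilde{\mathrm{coev}}_A\otimes\mathrm{id}_A)$ from $A$ to $A^*$ (using both coevaluations of the pivotal structure). For commutative $A$ one has $N_A=\theta_A$ and $\theta_A^2=\mathrm{id}_A$. A left module $(M,\rho_M)$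 over a commutative algebra $B$ is local if $\rho_M\circ c_{M,B}\circ c_{B,M}=\rho_M$. For left $B$-modules $M,N$, $M\otimes_B N$ denotes the coequaliser (existing in $\mathcal{C}$ as the image of an idempotent) of the two maps $\rho_M\otimes\mathrm{id}_N$ and $(\mathrm{id}_M\otimes\rho_N)\circ(c_{B,M}\otimes\mathrm{id}_N)$ from $B\otimes M\otimes N$ to $M\otimes N$. *)

(* Defs.v *)
From HB Require Import structures.
From mathcomp Require Import all_boot all_algebra.
Set Implicit Arguments. Unset Strict Implicit. Unset Printing Implicit Defensive.
Import GRing.Theory.
Local Open Scope ring_scope.

Record cat_data (k : fieldType) := CatData {
  Ob : Type;
  Mor : Ob -> Ob -> lmodType k;
  mcomp : forall X Y Z : Ob, Mor Y Z -> Mor X Y -> Mor X Z;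
  idm : forall X : Ob, Mor X X;
  tens : Ob -> Ob -> Ob;
  one_ob : Ob;
  tensH : forall X X' Y Y' : Ob, Mor X X' -> Mor Y Y' -> Mor (tens X Y) (tens X' Y');
  dualo : Ob -> Ob;
  ev : forall X : Ob, Mor (tens (dualo X) X) one_ob;
  coev : forall X : Ob, Mor one_ob (tens X (dualo X));
  br : forall X Y : Ob, Mor (tens X Y) (tens Y X);
  brinv : forall X Y : Ob, Mor (tens Y X) (tens X Y);
  tw : forall X : Ob, Mor X X;
  twinv : forall X : Ob, Mor X X;
  tensA : forall X Y Z : Ob, tens (tens X Y) Z = tens X (tens Y Z);
  tens1X : forall X : Ob, tens one_ob X = X;
  tensX1 : forall X : Ob, tens X one_ob = X
}.

Arguments Ob {k}.
Arguments Mor {k} c.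
Arguments mcomp {k c X Y Z}.
Arguments idm {k c}.
Arguments tens {k c}.
Arguments one_ob {k c}.
Arguments tensH {k c X X' Y Y'}.
Arguments dualo {k c}.
Arguments ev {k c}.
Arguments coev {k c}.
Arguments br {k c}.
Arguments brinv {k c}.
Arguments tw {k c}.
Arguments twinv {k c}.
Arguments tensA {k c}.
Arguments tens1X {k c}.
Arguments tensX1 {k c}.

Notation "g \oc f" := (mcomp g f) (at level 40, left associativity).
Notation "f \ot g" := (tensH f g) (at level 38, left associativity).

Section CatDefs.
Variables (k : fieldType) (C : cat_data k).

Definition hcast (X X' Y Y' : Ob C) (e1 : X = X') (e2 : Y = Y') (f : Mor C X Y)
  : Mor C X' Y' :=
  match e1 in _ = X0 return Mor C X0 Y' with
  | erefl => match e2 in _ = Y0 return Mor C X Y0 with erefl => f end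
  end.

Definition asc (X Y Z : Ob C) : Mor C (tens (tens X Y) Z) (tens X (tens Y Z)) :=
  hcast (esym (tensA X Y Z)) (erefl _) (idm _).
Definition asci (X Y Z : Ob C) : Mor C (tens X (tens Y Z)) (tens (tens X Y) Z) :=
  hcast (tensA X Y Z) (erefl _) (idm _).
Definition lu (X : Ob C) : Mor C (tens one_ob X) X :=
  hcast (esym (tens1X X)) (erefl _) (idm X).
Definition lui (X : Ob C) : Mor C X (tens one_ob X) :=
  hcast (erefl _) (esym (tens1X X)) (idm X).
Definition ru (X : Ob C) : Mor C (tens X one_ob) X :=
  hcast (esym (tensX1 X)) (erefl _) (idm X).
Definition rui (X : Ob C) : Mor C X (tens X one_ob) :=
  hcast (erefl _) (esym (tensX1 X)) (idm X).

Definition dualH (X Y : Ob C) (f : Mor C X Y) : Mor C (dualo Y) (dualo X) :=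
  lu (dualo X) \oc (ev Y \ot idm (dualo X)) \oc asci _ _ _
  \oc (idm (dualo Y) \ot (f \ot idm (dualo X))) \oc (idm (dualo Y) \ot coev X)
  \oc rui (dualo Y).

(* the right (co)evaluations of the pivotal structure induced by the ribbon
   structure (Kassel, Quantum Groups, XIV.3) *)
Definition evt (X : Ob C) : Mor C (tens X (dualo X)) one_ob :=
  ev X \oc br X (dualo X) \oc (tw X \ot idm (dualo X)).
Definition coevt (X : Ob C) : Mor C one_ob (tens (dualo X) X) :=
  (idm (dualo X) \ot tw X) \oc br X (dualo X) \oc coev X.

Definition cdim (X : Ob C) : Mor C one_ob one_ob := evt X \oc coev X.

Definition is_iso (X Y : Ob C) (f : Mor C X Y) : Prop :=
  exists g : Mor C Y X, g \oc f = idm X /\ f \oc g = idm Y.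

Definition ribbon_axioms : Prop :=
  ((
   (((forall (X Y Z W : Ob C) (f : Mor C X Y) (g : Mor C Y Z) (h : Mor C Z W),
          h \oc (g \oc f) = (h \oc g) \oc f)) /\ ((forall (X Y : Ob C) (f : Mor C X Y), idm Y \oc f = f)) /\ ((forall (X Y : Ob C) (f : Mor C X Y), f \oc idm X = f)) /\ ((forall (X Y Z : Ob C) (a : k) (g g' : Mor C Y Z) (f : Mor C X Y),
          (a *: g + g') \oc f = a *: (g \oc f) + g' \oc f)) /\ ((forall (X Y Z : Ob C) (a : k) (g : Mor C Y Z) (f f' : Mor C X Y),
          g \oc (a *: f + f') = a *: (g \oc f) + g \oc f')))) /\ (
   (((forall (X X' Y Y' : Ob C) (a : k) (f f' : Mor C X X') (g : Mor C Y Y'),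
          (a *: f + f') \ot g = a *: (f \ot g) + f' \ot g)) /\ ((forall (X X' Y Y' : Ob C) (a : k) (f : Mor C X X') (g g' : Mor C Y Y'),
          f \ot (a *: g + g') = a *: (f \ot g) + f \ot g')) /\ ((forall (X X' X'' Y Y' Y'' : Ob C) (f : Mor C X X') (f' : Mor C X' X'')
               (g : Mor C Y Y') (g' : Mor C Y' Y''),
          (f' \oc f) \ot (g' \oc g) = (f' \ot g') \oc (f \ot g))) /\ ((forall (X Y : Ob C), idm X \ot idm Y = idm (tens X Y))) /\ ((forall (X X' Y Y' Z Z' : Ob C) (f : Mor C X X') (g : Mor C Y Y') (h : Mor C Z Z'),
          (f \ot g) \ot h = hcast (esym (tensA X Y Z)) (esym (tensA X' Y' Z'))
                                  (f \ot (g \ot h)))) /\ ((forall (X Y : Ob C) (f : Mor C X Y),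
          idm one_ob \ot f = hcast (esym (tens1X X)) (esym (tens1X Y)) f)) /\ ((forall (X Y : Ob C) (f : Mor C X Y),
          f \ot idm one_ob = hcast (esym (tensX1 X)) (esym (tensX1 Y)) f)))) /\ (
   (((forall (X Y : Ob C), brinv X Y \oc br X Y = idm (tens X Y))) /\ ((forall (X Y : Ob C), br X Y \oc brinv X Y = idm (tens Y X))) /\ ((forall (X X' Y Y' : Ob C) (f : Mor C X X') (g : Mor C Y Y'),
          br X' Y' \oc (f \ot g) = (g \ot f) \oc br X Y)) /\ ((forall (X Y Z : Ob C),
          br X (tens Y Z) = asci Y Z X \oc (idm Y \ot br X Z) \oc asc Y X Z
                            \oc (br X Y \ot idm Z) \oc asci X Y Z)) /\ ((forall (X Y Z : Ob C),
          br (tens X Y) Z = asc Z X Y \oc (br X Z \ot idm Y) \oc asci X Z Y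
                            \oc (idm X \ot br Y Z) \oc asc X Y Z)))) /\ (
   (((forall (X : Ob C), ru X \oc (idm X \ot ev X) \oc asc _ _ _ \oc (coev X \ot idm X)
                  \oc lui X = idm X)) /\ ((forall (X : Ob C), lu (dualo X) \oc (ev X \ot idm (dualo X)) \oc asci _ _ _
                  \oc (idm (dualo X) \ot coev X) \oc rui (dualo X) = idm (dualo X))))) /\ (
   (((forall (X : Ob C), twinv X \oc tw X = idm X)) /\ ((forall (X : Ob C), tw X \oc twinv X = idm X)) /\ ((forall (X Y : Ob C) (f : Mor C X Y), tw Y \oc f = f \oc tw X)) /\ ((forall (X Y : Ob C), tw (tens X Y) = br Y X \oc br X Y \oc (tw X \ot tw Y))) /\ ((forall (X : Ob C), tw (dualo X) = dualH (tw X))))) /\ (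
   (((exists Z : Ob C, idm Z = 0)) /\ ((forall X Y : Ob C, exists (S : Ob C) (i1 : Mor C X S) (i2 : Mor C Y S)
                                  (p1 : Mor C S X) (p2 : Mor C S Y),
          ((p1 \oc i1 = idm X) /\ (p2 \oc i2 = idm Y) /\ (p1 \oc i2 = 0) /\ (p2 \oc i1 = 0) /\ (i1 \oc p1 + i2 \oc p2 = idm S)))))) /\ (
   (forall (X : Ob C) (e : Mor C X X), e \oc e = e ->
      exists (Y : Ob C) (i : Mor C Y X) (p : Mor C X Y),
        p \oc i = idm Y /\ i \oc p = e)) /\ (
   (idm (one_ob : Ob C) != 0 /\
    forall f : Mor C one_ob one_ob, exists a : k, f = a *: idm one_ob))).

Section Frob.
Variables (A : Ob C) (mu : Mor C (tens A A) A) (eta : Mor C one_ob A)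
          (Delta : Mor C A (tens A A)) (eps : Mor C A one_ob).

Definition is_frobenius_algebra : Prop :=
  ((mu \oc (mu \ot idm A) = mu \oc (idm A \ot mu) \oc asc A A A) /\ (mu \oc (eta \ot idm A) = lu A) /\ (mu \oc (idm A \ot eta) = ru A) /\ (asc A A A \oc (Delta \ot idm A) \oc Delta = (idm A \ot Delta) \oc Delta) /\ ((eps \ot idm A) \oc Delta = lui A) /\ ((idm A \ot eps) \oc Delta = rui A) /\ ((idm A \ot mu) \oc asc A A A \oc (Delta \ot idm A) = Delta \oc mu) /\ ((mu \ot idm A) \oc asci A A A \oc (idm A \ot Delta) = Delta \oc mu)).

Definition is_commutative : Prop := mu \oc br A A = mu.

Definition is_Delta_separable : Prop := mu \oc Delta = idm A.

Definition is_special : Prop :=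
  (exists a : k, a != 0 /\ eps \oc eta = a *: idm one_ob) /\
  (exists b : k, b != 0 /\ mu \oc Delta = b *: idm A).

Definition is_haploid : Prop :=
  exists v : Mor C one_ob A, v != 0 /\ forall f : Mor C one_ob A, exists a : k, f = a *: v.

Definition kappa : Mor C (tens A A) one_ob := eps \oc mu.

Definition Phi1 : Mor C A (dualo A) :=
  lu (dualo A) \oc (kappa \ot idm (dualo A)) \oc asci A A (dualo A)
  \oc (idm A \ot coev A) \oc rui A.

Definition Phi2 : Mor C A (dualo A) :=
  ru (dualo A) \oc (idm (dualo A) \ot kappa) \oc asc (dualo A) A A
  \oc (coevt A \ot idm A) \oc lui A.

(* Nakayama automorphism N_A = Phi1^{-1} o Phi2 is the identity *)
Definition is_symmetric : Prop :=
  exists g : Mor C (dualo A) A,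
    ((g \oc Phi1 = idm A) /\ (Phi1 \oc g = idm (dualo A)) /\ (g \oc Phi2 = idm A)).

End Frob.

Section Modules.
Variables (B : Ob C) (muB : Mor C (tens B B) B) (etaB : Mor C one_ob B).

Definition is_left_module (M : Ob C) (rho : Mor C (tens B M) M) : Prop :=
  rho \oc (muB \ot idm M) = rho \oc (idm B \ot rho) \oc asc B B M /\
  rho \oc (etaB \ot idm M) = lu M.

Definition is_local (M : Ob C) (rho : Mor C (tens B M) M) : Prop :=
  rho \oc br M B \oc br B M = rho.

Definition is_coequaliser (X Y Q : Ob C) (f1 f2 : Mor C X Y) (q : Mor C Y Q) : Prop :=
  q \oc f1 = q \oc f2 /\
  forall (Z : Ob C) (g : Mor C Y Z), g \oc f1 = g \oc f2 ->
    exists h : Mor C Q Z, h \oc q = g /\ forall h' : Mor C Q Z, h' \oc q = g -> h' = h.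

Definition tensB_map1 (M N : Ob C) (rhoM : Mor C (tens B M) M) :
  Mor C (tens (tens B M) N) (tens M N) := rhoM \ot idm N.
Definition tensB_map2 (M N : Ob C) (rhoN : Mor C (tens B N) N) :
  Mor C (tens (tens B M) N) (tens M N) :=
  (idm M \ot rhoN) \oc asc M B N \oc (br B M \ot idm N).

Definition is_tensor_over (M N : Ob C) (rhoM : Mor C (tens B M) M)
  (rhoN : Mor C (tens B N) N) (Q : Ob C) : Prop :=
  exists (P : Ob C) (q : Mor C (tens M N) P),
    is_coequaliser (tensB_map1 N rhoM) (tensB_map2 M rhoN) q /\
    exists phi : Mor C P Q, is_iso phi.

End Modules.

End CatDefs.

Record ribbon_cat (k : fieldType) := RibbonCat {
  rc_data :> cat_data k;
  rc_axioms : ribbon_axioms rc_data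
}.

(* Main.v *)
Require Import Defs.
From mathcomp Require Import all_boot all_algebra.
From Stdlib Require Import ProofIrrelevance.
Set Implicit Arguments. Unset Strict Implicit. Unset Printing Implicit Defensive.
Import GRing.Theory.
Local Open Scope ring_scope.


(** The Nakayama automorphism of a commutative Frobenius algebra is its twist, an
    involutive algebra automorphism.  The bubble mu o (theta (x) id) o Delta is a
    module map both in the ordinary sense and twisted by theta, so on a haploid
    algebra it equals both l id and l theta for a scalar l; hence it vanishes when
    theta <> id.  Its value between eta and epsilon is dim A.  The vanishing also gives
    mu o (p_+ (x) id) o Delta = 1/2 = mu o (p_- (x) id) o Delta, which makes
    B special and twice the F (x) F component of the comultiplication a section of the
    product F (x) F -> B, exhibiting B as the coequaliser F (x)_B F. *)

(** * Calculus in a linear ribbon category: the axioms as rewrite rules *)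

Section RibbonCalculus.
Variables (k : fieldType) (C : ribbon_cat k).
Notation Hom := (Mor C).
Notation "''id'" := (idm _) (at level 0).

Lemma mcompA (X Y Z W : Ob C) (f : Hom X Y) (g : Hom Y Z) (h : Hom Z W) :
  h \oc (g \oc f) = h \oc g \oc f.
Proof. by case: (rc_axioms C) => [[H _] _]; exact: H. Qed.

Lemma comp1m (X Y : Ob C) (f : Hom X Y) : idm Y \oc f = f.
Proof. by case: (rc_axioms C) => [[_ [H _]] _]; exact: H. Qed.

Lemma compm1 (X Y : Ob C) (f : Hom X Y) : f \oc idm X = f.
Proof. by case: (rc_axioms C) => [[_ [_ [H _]]] _]; exact: H. Qed.

Lemma complinl (X Y Z : Ob C) (a : k) (g g' : Hom Y Z) (f : Hom X Y) :
  (a *: g + g') \oc f = a *: (g \oc f) + g' \oc f.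
Proof. by case: (rc_axioms C) => [[_ [_ [_ [H _]]]] _]; exact: H. Qed.

Lemma complinr (X Y Z : Ob C) (a : k) (g : Hom Y Z) (f f' : Hom X Y) :
  g \oc (a *: f + f') = a *: (g \oc f) + g \oc f'.
Proof. by case: (rc_axioms C) => [[_ [_ [_ [_ H]]]] _]; exact: H. Qed.

Lemma tenslinl (X X' Y Y' : Ob C) (a : k) (f f' : Hom X X') (g : Hom Y Y') :
  (a *: f + f') \ot g = a *: (f \ot g) + f' \ot g.
Proof. by case: (rc_axioms C) => [_ [[H _] _]]; exact: H. Qed.

Lemma tenslinr (X X' Y Y' : Ob C) (a : k) (f : Hom X X') (g g' : Hom Y Y') :
  f \ot (a *: g + g') = a *: (f \ot g) + f \ot g'.
Proof. by case: (rc_axioms C) => [_ [[_ [H _]] _]]; exact: H. Qed.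

Lemma tensM (X X' X'' Y Y' Y'' : Ob C) (f : Hom X X') (f' : Hom X' X'')
    (g : Hom Y Y') (g' : Hom Y' Y'') :
  (f' \ot g') \oc (f \ot g) = (f' \oc f) \ot (g' \oc g).
Proof. by case: (rc_axioms C) => [_ [[_ [_ [H _]]] _]]; rewrite H. Qed.

Lemma tens11 (X Y : Ob C) : idm X \ot idm Y = idm (tens X Y) :> Hom _ _.
Proof. by case: (rc_axioms C) => [_ [[_ [_ [_ [H _]]]] _]]; exact: H. Qed.

Lemma hcast_tensA (X X' Y Y' Z Z' : Ob C) (f : Hom X X') (g : Hom Y Y') (h : Hom Z Z') :
  (f \ot g) \ot h = hcast (esym (tensA X Y Z)) (esym (tensA X' Y' Z')) (f \ot (g \ot h)).
Proof. by case: (rc_axioms C) => [_ [[_ [_ [_ [_ [H _]]]]] _]]; exact: H. Qed.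

Lemma hcast_tens1X (X Y : Ob C) (f : Hom X Y) :
  idm one_ob \ot f = hcast (esym (tens1X X)) (esym (tens1X Y)) f.
Proof. by case: (rc_axioms C) => [_ [[_ [_ [_ [_ [_ [H _]]]]]] _]]; exact: H. Qed.

Lemma hcast_tensX1 (X Y : Ob C) (f : Hom X Y) :
  f \ot idm one_ob = hcast (esym (tensX1 X)) (esym (tensX1 Y)) f.
Proof. by case: (rc_axioms C) => [_ [[_ [_ [_ [_ [_ [_ H]]]]]] _]]; exact: H. Qed.

Lemma brK (X Y : Ob C) : brinv X Y \oc br X Y = idm (tens X Y) :> Hom _ _.
Proof. by case: (rc_axioms C) => [_ [_ [[H _] _]]]; exact: H. Qed.

Lemma brinvK (X Y : Ob C) : br X Y \oc brinv X Y = idm (tens Y X) :> Hom _ _.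
Proof. by case: (rc_axioms C) => [_ [_ [[_ [H _]] _]]]; exact: H. Qed.

Lemma br_nat (X X' Y Y' : Ob C) (f : Hom X X') (g : Hom Y Y') :
  br X' Y' \oc (f \ot g) = (g \ot f) \oc br X Y.
Proof. by case: (rc_axioms C) => [_ [_ [[_ [_ [H _]]] _]]]; exact: H. Qed.

Lemma hexagonr (X Y Z : Ob C) :
  br X (tens Y Z) = asci Y Z X \oc (idm Y \ot br X Z) \oc asc Y X Z
                    \oc (br X Y \ot idm Z) \oc asci X Y Z :> Hom _ _.
Proof. by case: (rc_axioms C) => [_ [_ [[_ [_ [_ [H _]]]] _]]]; exact: H. Qed.

Lemma hexagonl (X Y Z : Ob C) :
  br (tens X Y) Z = asc Z X Y \oc (br X Z \ot idm Y) \oc asci X Z Y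
                    \oc (idm X \ot br Y Z) \oc asc X Y Z :> Hom _ _.
Proof. by case: (rc_axioms C) => [_ [_ [[_ [_ [_ [_ H]]]] _]]]; exact: H. Qed.

Lemma ev_coev_zigzag (X : Ob C) :
  ru X \oc (idm X \ot ev X) \oc asc _ _ _ \oc (coev X \ot idm X) \oc lui X = idm X :> Hom _ _.
Proof. by case: (rc_axioms C) => [_ [_ [_ [[H _] _]]]]; exact: H. Qed.

Lemma coev_ev_zigzag (X : Ob C) :
  lu (dualo X) \oc (ev X \ot idm (dualo X)) \oc asci _ _ _
    \oc (idm (dualo X) \ot coev X) \oc rui (dualo X) = idm (dualo X) :> Hom _ _.
Proof. by case: (rc_axioms C) => [_ [_ [_ [[_ H] _]]]]; exact: H. Qed.

Lemma twK (X : Ob C) : twinv X \oc tw X = idm X :> Hom _ _.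
Proof. by case: (rc_axioms C) => [_ [_ [_ [_ [[H _] _]]]]]; exact: H. Qed.

Lemma tw_nat (X Y : Ob C) (f : Hom X Y) : tw Y \oc f = f \oc tw X.
Proof. by case: (rc_axioms C) => [_ [_ [_ [_ [[_ [_ [H _]]] _]]]]]; exact: H. Qed.

Lemma tw_tens (X Y : Ob C) :
  tw (tens X Y) = br Y X \oc br X Y \oc (tw X \ot tw Y) :> Hom _ _.
Proof. by case: (rc_axioms C) => [_ [_ [_ [_ [[_ [_ [_ [H _]]]] _]]]]]; exact: H. Qed.

Lemma tw_dual (X : Ob C) : tw (dualo X) = dualH (tw X) :> Hom _ _.
Proof. by case: (rc_axioms C) => [_ [_ [_ [_ [[_ [_ [_ [_ H]]]] _]]]]]; exact: H. Qed.

(** * Bilinearity of composition and of the tensor product *)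

Lemma comp0l (X Y Z : Ob C) (f : Hom X Y) : (0 : Hom Y Z) \oc f = 0.
Proof.
have := complinl 1 (0 : Hom Y Z) 0 f; rewrite scaler0 addr0 scale1r.
by move/eqP; rewrite -subr_eq0 opprD addNKr oppr_eq0 => /eqP.
Qed.

Lemma comp0r (X Y Z : Ob C) (g : Hom Y Z) : g \oc (0 : Hom X Y) = 0.
Proof.
have := complinr 1 g (0 : Hom X Y) 0; rewrite scaler0 addr0 scale1r.
by move/eqP; rewrite -subr_eq0 opprD addNKr oppr_eq0 => /eqP.
Qed.

Lemma tens0l (X X' Y Y' : Ob C) (g : Hom Y Y') : (0 : Hom X X') \ot g = 0.
Proof.
have := tenslinl 1 (0 : Hom X X') 0 g; rewrite scaler0 addr0 scale1r.
by move/eqP; rewrite -subr_eq0 opprD addNKr oppr_eq0 => /eqP.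
Qed.

Lemma tens0r (X X' Y Y' : Ob C) (f : Hom X X') : f \ot (0 : Hom Y Y') = 0.
Proof.
have := tenslinr 1 f (0 : Hom Y Y') 0; rewrite scaler0 addr0 scale1r.
by move/eqP; rewrite -subr_eq0 opprD addNKr oppr_eq0 => /eqP.
Qed.

Lemma compZl (X Y Z : Ob C) (a : k) (g : Hom Y Z) (f : Hom X Y) :
  (a *: g) \oc f = a *: (g \oc f).
Proof. by rewrite -[a *: g]addr0 complinl comp0l addr0. Qed.

Lemma compZr (X Y Z : Ob C) (a : k) (g : Hom Y Z) (f : Hom X Y) :
  g \oc (a *: f) = a *: (g \oc f).
Proof. by rewrite -[a *: f]addr0 complinr comp0r addr0. Qed.

Lemma compDl (X Y Z : Ob C) (g g' : Hom Y Z) (f : Hom X Y) :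
  (g + g') \oc f = g \oc f + g' \oc f.
Proof. by rewrite -[g in LHS]scale1r complinl scale1r. Qed.

Lemma compDr (X Y Z : Ob C) (g : Hom Y Z) (f f' : Hom X Y) :
  g \oc (f + f') = g \oc f + g \oc f'.
Proof. by rewrite -[f in LHS]scale1r complinr scale1r. Qed.

Lemma compNl (X Y Z : Ob C) (g : Hom Y Z) (f : Hom X Y) : (- g) \oc f = - (g \oc f).
Proof. by rewrite -scaleN1r compZl scaleN1r. Qed.

Lemma compNr (X Y Z : Ob C) (g : Hom Y Z) (f : Hom X Y) : g \oc (- f) = - (g \oc f).
Proof. by rewrite -scaleN1r compZr scaleN1r. Qed.

Lemma tensZl (X X' Y Y' : Ob C) (a : k) (f : Hom X X') (g : Hom Y Y') :
  (a *: f) \ot g = a *: (f \ot g).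
Proof. by rewrite -[a *: f]addr0 tenslinl tens0l addr0. Qed.

Lemma tensZr (X X' Y Y' : Ob C) (a : k) (f : Hom X X') (g : Hom Y Y') :
  f \ot (a *: g) = a *: (f \ot g).
Proof. by rewrite -[a *: g]addr0 tenslinr tens0r addr0. Qed.

Lemma tensDl (X X' Y Y' : Ob C) (f f' : Hom X X') (g : Hom Y Y') :
  (f + f') \ot g = f \ot g + f' \ot g.
Proof. by rewrite -[f in LHS]scale1r tenslinl scale1r. Qed.

Lemma tensDr (X X' Y Y' : Ob C) (f : Hom X X') (g g' : Hom Y Y') :
  f \ot (g + g') = f \ot g + f \ot g'.
Proof. by rewrite -[g in LHS]scale1r tenslinr scale1r. Qed.

Lemma tensNl (X X' Y Y' : Ob C) (f : Hom X X') (g : Hom Y Y') :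
  (- f) \ot g = - (f \ot g).
Proof. by rewrite -scaleN1r tensZl scaleN1r. Qed.

Lemma tensNr (X X' Y Y' : Ob C) (f : Hom X X') (g : Hom Y Y') :
  f \ot (- g) = - (f \ot g).
Proof. by rewrite -scaleN1r tensZr scaleN1r. Qed.

Lemma comp_eq (X Y Z W : Ob C) (f : Hom Y Z) (g : Hom X Y) (h : Hom X Z) :
  f \oc g = h -> forall m : Hom Z W, m \oc f \oc g = m \oc h.
Proof. by move=> fg m; rewrite -mcompA fg. Qed.

Lemma comp_eq3 (X Y Z W U : Ob C) (f : Hom Z W) (g : Hom Y Z) (h : Hom X Y) (l : Hom X W) :
  f \oc g \oc h = l -> forall m : Hom W U, m \oc f \oc g \oc h = m \oc l.
Proof. by move=> <- m; rewrite !mcompA. Qed.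

Lemma tensl_comp (X X' X'' Y : Ob C) (f : Hom X X') (f' : Hom X' X'') :
  (f' \oc f) \ot idm Y = (f' \ot 'id) \oc (f \ot 'id).
Proof. by rewrite tensM comp1m. Qed.

Lemma tensr_comp (X X' X'' Y : Ob C) (f : Hom X X') (f' : Hom X' X'') :
  idm Y \ot (f' \oc f) = ('id \ot f') \oc ('id \ot f).
Proof. by rewrite tensM comp1m. Qed.

Lemma tens_splitl (X X' Y Y' : Ob C) (f : Hom X X') (g : Hom Y Y') :
  f \ot g = (f \ot 'id) \oc ('id \ot g).
Proof. by rewrite tensM comp1m compm1. Qed.

Lemma tens_splitr (X X' Y Y' : Ob C) (f : Hom X X') (g : Hom Y Y') :
  f \ot g = ('id \ot g) \oc (f \ot 'id).
Proof. by rewrite tensM comp1m compm1. Qed.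

(** * Strictness, coherence and naturality of the structural isomorphisms *)

Definition eqmor (X Y : Ob C) (e : X = Y) : Hom X Y := hcast erefl e (idm X).

Lemma hcast_eqmor (X X' Y Y' : Ob C) (e1 : X = X') (e2 : Y = Y') (f : Hom X Y) :
  hcast e1 e2 f = eqmor e2 \oc f \oc eqmor (esym e1).
Proof. by case: X' / e1; case: Y' / e2; rewrite /eqmor /= comp1m compm1. Qed.

(** Strictness is an equality of objects, so associators and unitors are identities transported
    along such equalities. This class contains them all and is closed under composition and tensor
    product. *)
Definition structural (X Y : Ob C) (f : Hom X Y) := exists e, f = eqmor e.

(** Two transported identities with the same ends differ only in the proof of equality, and proof
    irrelevance identifies these proofs. This plays the part of Mac Lane's coherence theorem. *)
Lemma coherence (X Y : Ob C) (f g : Hom X Y) : structural f -> structural g -> f = g.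
Proof. by move=> [e ->] [e' ->]; rewrite (proof_irrelevance _ e e'). Qed.

Lemma structural_eqmor (X Y : Ob C) (e : X = Y) : structural (eqmor e).
Proof. by exists e. Qed.

Lemma structural_id (X : Ob C) : structural (idm X).
Proof. by exists erefl. Qed.

Lemma structural_comp (X Y Z : Ob C) (g : Hom Y Z) (f : Hom X Y) :
  structural g -> structural f -> structural (g \oc f).
Proof.
move=> [e ->] [e' ->] {f g}; exists (etrans e' e).
by case: Z / e; rewrite comp1m.
Qed.

Lemma structural_tens (X X' Y Y' : Ob C) (f : Hom X X') (g : Hom Y Y') :
  structural f -> structural g -> structural (f \ot g).
Proof.
move=> [e ->] [e' ->] {f g}; case: X' / e; case: Y' / e'.
by exists erefl; rewrite /eqmor /= tens11.
Qed.

Lemma structural_hcast (X Y Z : Ob C) (e : X = Y) (e' : X = Z) :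
  structural (hcast e e' (idm X)).
Proof. by case: Y / e; case: Z / e'; exists erefl. Qed.

Lemma structural_asc (X Y Z : Ob C) : structural (asc X Y Z).
Proof. exact: structural_hcast. Qed.
Lemma structural_asci (X Y Z : Ob C) : structural (asci X Y Z).
Proof. exact: structural_hcast. Qed.
Lemma structural_lu (X : Ob C) : structural (lu X).
Proof. exact: structural_hcast. Qed.
Lemma structural_lui (X : Ob C) : structural (lui X).
Proof. exact: structural_hcast. Qed.
Lemma structural_ru (X : Ob C) : structural (ru X).
Proof. exact: structural_hcast. Qed.
Lemma structural_rui (X : Ob C) : structural (rui X).
Proof. exact: structural_hcast. Qed.

Hint Resolve structural_eqmor structural_id structural_comp structural_tens
  structural_asc structural_asci structural_lu structural_lui structural_ru
  structural_rui : structural.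

Ltac cohere := apply: coherence; auto 20 with structural.

Lemma ascK (X Y Z : Ob C) : asci X Y Z \oc asc X Y Z = idm _ :> Hom _ _.
Proof. by cohere. Qed.
Lemma asciK (X Y Z : Ob C) : asc X Y Z \oc asci X Y Z = idm _ :> Hom _ _.
Proof. by cohere. Qed.
Lemma luK (X : Ob C) : lui X \oc lu X = idm _ :> Hom _ _.
Proof. by cohere. Qed.
Lemma luiK (X : Ob C) : lu X \oc lui X = idm _ :> Hom _ _.
Proof. by cohere. Qed.
Lemma ruK (X : Ob C) : rui X \oc ru X = idm _ :> Hom _ _.
Proof. by cohere. Qed.
Lemma ruiK (X : Ob C) : ru X \oc rui X = idm _ :> Hom _ _.
Proof. by cohere. Qed.

Lemma tensA3 (X X' Y Y' Z Z' : Ob C) (f : Hom X X') (g : Hom Y Y') (h : Hom Z Z') :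
  (f \ot g) \ot h = asci X' Y' Z' \oc (f \ot (g \ot h)) \oc asc X Y Z.
Proof. by rewrite hcast_tensA hcast_eqmor; congr (_ \oc _ \oc _); cohere. Qed.

Lemma asc_nat (X X' Y Y' Z Z' : Ob C) (f : Hom X X') (g : Hom Y Y') (h : Hom Z Z') :
  asc X' Y' Z' \oc ((f \ot g) \ot h) = (f \ot (g \ot h)) \oc asc X Y Z.
Proof. by rewrite tensA3 !mcompA asciK comp1m. Qed.

Lemma asci_nat (X X' Y Y' Z Z' : Ob C) (f : Hom X X') (g : Hom Y Y') (h : Hom Z Z') :
  asci X' Y' Z' \oc (f \ot (g \ot h)) = ((f \ot g) \ot h) \oc asci X Y Z.
Proof. by rewrite tensA3 -!mcompA asciK compm1. Qed.

Lemma lu_nat (X Y : Ob C) (f : Hom X Y) : lu Y \oc ('id \ot f) = f \oc lu X.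
Proof.
rewrite hcast_tens1X hcast_eqmor !mcompA.
have -> : lu Y \oc eqmor (esym (tens1X Y)) = 'id by cohere.
by rewrite comp1m; congr (_ \oc _); cohere.
Qed.

Lemma ru_nat (X Y : Ob C) (f : Hom X Y) : ru Y \oc (f \ot 'id) = f \oc ru X.
Proof.
rewrite hcast_tensX1 hcast_eqmor !mcompA.
have -> : ru Y \oc eqmor (esym (tensX1 Y)) = 'id by cohere.
by rewrite comp1m; congr (_ \oc _); cohere.
Qed.

Lemma lui_nat (X Y : Ob C) (f : Hom X Y) : lui Y \oc f = ('id \ot f) \oc lui X.
Proof.
by rewrite -[RHS]comp1m -luK -[lui Y \oc _ \oc _]mcompA [lu Y \oc _]mcompA lu_nat -!mcompA luiK compm1.
Qed.

Lemma rui_nat (X Y : Ob C) (f : Hom X Y) : rui Y \oc f = (f \ot 'id) \oc rui X.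
Proof.
by rewrite -[RHS]comp1m -ruK -[rui Y \oc _ \oc _]mcompA [ru Y \oc _]mcompA ru_nat -!mcompA ruiK compm1.
Qed.

Lemma lu1_ru1 : lu one_ob = ru one_ob :> Hom _ _.
Proof. by cohere. Qed.
Lemma lui1_rui1 : lui one_ob = rui one_ob :> Hom _ _.
Proof. by cohere. Qed.

(* The braiding with the unit object is structural: the hexagon for 1 (x) 1
   reads br = br o br up to structural isomorphisms. *)
Lemma br1X (Z : Ob C) : br one_ob Z = rui Z \oc lu Z :> Hom _ _.
Proof.
have Hn := br_nat (lu one_ob : Hom _ _) (idm Z).
rewrite hexagonl in Hn.
have E1 : idm one_ob \ot br one_ob Z = lui _ \oc br one_ob Z \oc lu _ :> Hom _ _.
  by rewrite -mcompA -lu_nat mcompA luK comp1m.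
have E2 : br one_ob Z \ot idm one_ob = rui _ \oc br one_ob Z \oc ru _ :> Hom _ _.
  by rewrite -mcompA -ru_nat mcompA ruK comp1m.
rewrite E1 E2 !mcompA in Hn.
have E3 : (idm Z \ot lu one_ob) \oc asc Z one_ob one_ob \oc rui (tens Z one_ob) = 'id by cohere.
rewrite E3 comp1m in Hn.
have {}Hn := congr1 (fun m => rui Z \oc lu Z \oc (brinv _ _ \oc m) \oc asci _ _ _ \oc lui _) Hn.
rewrite !mcompA in Hn.
rewrite -[rui Z \oc lu Z \oc brinv _ _ \oc br _ _]mcompA brK compm1 in Hn.
have E4 : rui Z \oc lu Z \oc ru (tens one_ob Z) \oc asci one_ob Z one_ob
   \oc lui (tens Z one_ob) = 'id by cohere.
rewrite E4 comp1m in Hn.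
rewrite -!mcompA in Hn.
have E5 : lu (tens one_ob Z) \oc (asc one_ob one_ob Z \oc (asci one_ob one_ob Z
  \oc lui (tens one_ob Z))) = 'id by cohere.
rewrite E5 compm1 in Hn.
rewrite -Hn.
by cohere.
Qed.

(** The mirror image of [br1X], from the other hexagon. *)
Lemma brX1 (Z : Ob C) : br Z one_ob = lui Z \oc ru Z :> Hom _ _.
Proof.
have Hn := br_nat (idm Z) (lu one_ob : Hom _ _).
rewrite hexagonr in Hn.
have E1 : idm one_ob \ot br Z one_ob = lui _ \oc br Z one_ob \oc lu _ :> Hom _ _.
  by rewrite -mcompA -lu_nat mcompA luK comp1m.
have E2 : br Z one_ob \ot idm one_ob = rui _ \oc br Z one_ob \oc ru _ :> Hom _ _.
  by rewrite -mcompA -ru_nat mcompA ruK comp1m.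
rewrite E1 E2 !mcompA in Hn.
have E3 : (lu one_ob \ot idm Z) \oc asci one_ob one_ob Z \oc lui (tens one_ob Z) = 'id by cohere.
rewrite E3 comp1m in Hn.
have {}Hn := congr1 (fun m => lui Z \oc ru Z \oc (brinv _ _ \oc m) \oc asc _ _ _ \oc rui _) Hn.
rewrite !mcompA in Hn.
rewrite -[lui Z \oc ru Z \oc brinv _ _ \oc br _ _]mcompA brK compm1 in Hn.
have E4 : lui Z \oc ru Z \oc lu (tens Z one_ob) \oc asc one_ob Z one_ob
   \oc rui (tens one_ob Z) = 'id by cohere.
rewrite E4 comp1m in Hn.
rewrite -!mcompA in Hn.
have E5 : ru (tens Z one_ob) \oc (asci Z one_ob one_ob \oc (asc Z one_ob one_ob
  \oc rui (tens Z one_ob))) = 'id by cohere.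
rewrite E5 compm1 in Hn.
rewrite -Hn.
by cohere.
Qed.

(** The braiding of the unit object with itself is structural, so the balancing identity on
    [tens one_ob one_ob] says that the twist of the unit equals its own square. An invertible
    idempotent is the identity. *)
Lemma tw1 : tw one_ob = 'id :> Hom _ _.
Proof.
have H := tw_nat (lu one_ob : Hom _ _).
rewrite tw_tens br1X lu1_ru1 -lui1_rui1 -!mcompA [ru _ \oc (lui _ \oc _)]mcompA in H.
rewrite -lu1_ru1 luiK comp1m !mcompA luiK comp1m tens_splitl mcompA [in RHS]lu1_ru1 ru_nat -mcompA in H.
rewrite -lu1_ru1 lu_nat in H.
have {}H := congr1 (fun m => twinv _ \oc m \oc lui _) H.
by rewrite !mcompA !twK !comp1m -[tw _ \oc _ \oc _]mcompA !luiK compm1 in H.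
Qed.

(** * Transposition along a pairing, and snake identities *)

Definition mate (L X Y : Ob C) (b : Hom (tens L X) one_ob) (u : Hom one_ob (tens X Y)) :
  Hom L Y := lu Y \oc (b \ot 'id) \oc asci L X Y \oc ('id \ot u) \oc rui L.

(** One of the two snake identities for a duality between [L] and [X]; the other one is
    [mate b c = 'id]. Here [mate] is the transpose that bends the [X] leg of a copairing round
    through [b]. *)
Definition zigzag (L X : Ob C) (b : Hom (tens L X) one_ob) (c : Hom one_ob (tens X L)) :=
  ru X \oc ('id \ot b) \oc asc X L X \oc (c \ot 'id) \oc lui X = 'id.

Lemma mate_compl (L L' X Y : Ob C) (f : Hom L' L) (b : Hom (tens L X) one_ob)
    (u : Hom one_ob (tens X Y)) : mate (b \oc (f \ot 'id)) u = mate b u \oc f.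
Proof.
rewrite /mate -[in RHS]mcompA rui_nat !mcompA -[in RHS](mcompA (f \ot _)).
rewrite -tens_splitr [f \ot u]tens_splitl mcompA -tens11.
by rewrite (comp_eq (asci_nat _ _ _)) !mcompA tensl_comp !mcompA.
Qed.

Lemma mate_compr (L X Y Y' : Ob C) (h : Hom Y Y') (b : Hom (tens L X) one_ob)
    (u : Hom one_ob (tens X Y)) : mate b (('id \ot h) \oc u) = h \oc mate b u.
Proof.
rewrite /mate tensr_comp !mcompA (comp_eq (asci_nat _ _ _)) !mcompA tens11.
by rewrite (comp_eq (tensM _ _ _ _)) compm1 comp1m tens_splitr mcompA lu_nat.
Qed.

Lemma mate_compm (L X X' Y : Ob C) (f : Hom X' X) (b : Hom (tens L X) one_ob)
    (u : Hom one_ob (tens X' Y)) :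
  mate (b \oc ('id \ot f)) u = mate b ((f \ot 'id) \oc u).
Proof.
by rewrite /mate tensr_comp !mcompA (comp_eq (asci_nat _ _ _)) !mcompA tensl_comp !mcompA.
Qed.

(** Attaching [c] undoes the transpose: the [X] strand running through [c] and [b] is a snake, which
    straightens. *)
Lemma zigzag_mate (L X Y : Ob C) (b : Hom (tens L X) one_ob) (c : Hom one_ob (tens X L))
    (u : Hom one_ob (tens X Y)) : zigzag b c -> ('id \ot mate b u) \oc c = u.
Proof.
move=> bc; rewrite /mate !tensr_comp.
(* By interchange [u] can be applied before [c]; it then cancels from both sides. *)
have slide : ('id \ot ('id \ot u)) \oc ('id \ot rui L) \oc c
    = asc X L (tens X Y) \oc (c \ot 'id) \oc lui _ \oc u.
  rewrite -[RHS]mcompA lui_nat !mcompA [in RHS](comp_eq (tensM _ _ _ _)) compm1 comp1m.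
  rewrite [c \ot u]tens_splitr -[idm (tens X L)]tens11 !mcompA asc_nat lui1_rui1 -[RHS]mcompA -rui_nat !mcompA.
  by congr (_ \oc _); rewrite -[RHS]mcompA; congr (_ \oc _); cohere.
rewrite -!mcompA [('id \ot ('id \ot u)) \oc _]mcompA slide !mcompA.
rewrite -[RHS]comp1m; congr (_ \oc _).
have Hb : idm X \ot (b \ot idm Y) = asc _ _ _ \oc (('id \ot b) \ot 'id) \oc asci _ _ _.
  by rewrite asc_nat -mcompA asciK compm1.
have Hc : c \ot idm (tens X Y) = asc _ _ _ \oc ((c \ot 'id) \ot 'id) \oc asci _ _ _.
  by rewrite asc_nat tens11 -mcompA asciK compm1.
rewrite Hb Hc !mcompA.
(* What remains is the snake tensored with the spectator strand [Y], up to structural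
   isomorphisms. *)
transitivity ((ru X \ot 'id) \oc (('id \ot b) \ot 'id) \oc (asc X L X \ot 'id)
  \oc ((c \ot 'id) \ot 'id) \oc (lui X \ot idm Y)); last first.
  by rewrite -!tensl_comp bc tens11.
have -> : ('id \ot lu Y) \oc asc X one_ob Y = ru X \ot 'id by cohere.
rewrite -!mcompA; congr (_ \oc (_ \oc _)).
rewrite !mcompA.
have -> : asci X (tens L X) Y \oc (idm X \ot asci L X Y) \oc asc X L (tens X Y)
   \oc asc (tens X L) X Y = asc X L X \ot 'id by cohere.
by rewrite -!mcompA; congr (_ \oc (_ \oc _)); cohere.
Qed.

Lemma mate_inj (L X Y : Ob C) (b : Hom (tens L X) one_ob) (c : Hom one_ob (tens X L))
    (u v : Hom one_ob (tens X Y)) : zigzag b c -> mate b u = mate b v -> u = v.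
Proof. by move=> bc uv; rewrite -(zigzag_mate u bc) uv (zigzag_mate v bc). Qed.

(** The companion of [zigzag_mate] for pairings: the same snake is straightened, now with [L'] as
    the spectator strand. *)
Lemma zigzag_mate_pairing (L L' X : Ob C) (b : Hom (tens L X) one_ob)
    (c : Hom one_ob (tens X L)) (b' : Hom (tens L' X) one_ob) :
  zigzag b c -> b \oc (mate b' c \ot 'id) = b'.
Proof.
move=> bc; rewrite /mate !tensl_comp !mcompA.
have -> : lu L \ot idm X = lu (tens L X) \oc asc _ _ _ by cohere.
rewrite !mcompA -lu_nat -[_ \oc asc _ _ _ \oc _]mcompA asc_nat tens11 mcompA.
rewrite -[_ \oc ('id \ot b) \oc _]mcompA -tens_splitr [b' \ot b]tens_splitl mcompA lu1_ru1 ru_nat.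
have Hb : idm (tens L' X) \ot b = asci _ _ _ \oc ('id \ot ('id \ot b)) \oc asc _ _ _.
  by rewrite asci_nat tens11 -mcompA ascK compm1.
have Hc : (idm L' \ot c) \ot idm X = asci _ _ _ \oc ('id \ot (c \ot 'id)) \oc asc _ _ _.
  by rewrite asci_nat -mcompA ascK compm1.
rewrite Hb Hc -!mcompA -[RHS]compm1; congr (_ \oc _); rewrite !mcompA.
transitivity (('id \ot ru X) \oc ('id \ot ('id \ot b)) \oc ('id \ot asc X L X)
  \oc ('id \ot (c \ot 'id)) \oc (idm L' \ot lui X)); last first.
  by rewrite -!tensr_comp bc tens11.
have -> : ru (tens L' X) \oc asci L' X one_ob = 'id \ot ru X by cohere.
rewrite -!mcompA; congr (_ \oc (_ \oc _)).
rewrite !mcompA.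
have -> : asc L' X (tens L X) \oc asc (tens L' X) L X \oc (asci L' X L \ot 'id)
   \oc asci L' (tens X L) X = 'id \ot asc X L X by cohere.
by rewrite -!mcompA; congr (_ \oc (_ \oc _)); cohere.
Qed.

Lemma zigzag_ev_coev (X : Ob C) : zigzag (ev X : Hom _ _) (coev X).
Proof. exact: ev_coev_zigzag. Qed.

Lemma mate_ev_coev (X : Ob C) : mate (ev X : Hom _ _) (coev X) = 'id.
Proof. exact: coev_ev_zigzag. Qed.

Lemma dualH_mate (X Y : Ob C) (f : Hom X Y) :
  dualH f = mate (ev Y) ((f \ot 'id) \oc coev X).
Proof. by rewrite /mate tensr_comp !mcompA. Qed.

Lemma ev_dualH (X Y : Ob C) (f : Hom X Y) :
  ev X \oc (dualH f \ot 'id) = ev Y \oc ('id \ot f).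
Proof. by rewrite dualH_mate -mate_compm (zigzag_mate_pairing _ (zigzag_ev_coev X)). Qed.

End RibbonCalculus.

(** * The Frobenius axioms by name *)

Section FrobeniusAxioms.
Variables (k : fieldType) (C : ribbon_cat k).
Notation Hom := (Mor C).
Notation "''id'" := (idm _) (at level 0).
Variables (A : Ob C) (mu : Hom (tens A A) A) (eta : Hom one_ob A)
  (Delta : Hom A (tens A A)) (eps : Hom A one_ob).
Hypothesis frobA : is_frobenius_algebra mu eta Delta eps.

Lemma frob_mulA : mu \oc (mu \ot 'id) = mu \oc ('id \ot mu) \oc asc A A A.
Proof. by case: frobA. Qed.

Lemma frob_mul1l : mu \oc (eta \ot 'id) = lu A.
Proof. by case: frobA => [_ [H _]]. Qed.

Lemma frob_mul1r : mu \oc ('id \ot eta) = ru A.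
Proof. by case: frobA => [_ [_ [H _]]]. Qed.

Lemma frob_comulA : asc A A A \oc (Delta \ot 'id) \oc Delta = ('id \ot Delta) \oc Delta.
Proof. by case: frobA => [_ [_ [_ [H _]]]]. Qed.

Lemma frob_counitl : (eps \ot 'id) \oc Delta = lui A.
Proof. by case: frobA => [_ [_ [_ [_ [H _]]]]]. Qed.

Lemma frob_counitr : ('id \ot eps) \oc Delta = rui A.
Proof. by case: frobA => [_ [_ [_ [_ [_ [H _]]]]]]. Qed.

Lemma frob_comul_mull : ('id \ot mu) \oc asc A A A \oc (Delta \ot 'id) = Delta \oc mu.
Proof. by case: frobA => [_ [_ [_ [_ [_ [_ [H _]]]]]]]. Qed.

Lemma frob_comul_mulr : (mu \ot 'id) \oc asci A A A \oc ('id \ot Delta) = Delta \oc mu.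
Proof. by case: frobA => [_ [_ [_ [_ [_ [_ [_ H]]]]]]]. Qed.

End FrobeniusAxioms.

(** * Commutative Frobenius algebras: the Nakayama automorphism is the twist *)

Section CommutativeFrobenius.
Variables (k : fieldType) (C : ribbon_cat k).
Notation Hom := (Mor C).
Notation "''id'" := (idm _) (at level 0).
Variables (A : Ob C) (mu : Hom (tens A A) A) (eta : Hom one_ob A)
  (Delta : Hom A (tens A A)) (eps : Hom A one_ob).
Hypothesis frobA : is_frobenius_algebra mu eta Delta eps.
Hypothesis comA : is_commutative mu.

Let muA := frob_mulA frobA.
Let mu1l := frob_mul1l frobA.
Let mu1r := frob_mul1r frobA.
Let epsl := frob_counitl frobA.
Let epsr := frob_counitr frobA.
Let frobl := frob_comul_mull frobA.
Let frobr := frob_comul_mulr frobA.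

Local Notation kap := (kappa mu eps).
Local Notation gam := (Delta \oc eta).

(** A Frobenius relation turns the snake into [Delta \oc mu] with a unit below and a counit above,
    and the unit and counit laws finish. *)
Lemma kappa_zigzag : zigzag kap gam.
Proof.
rewrite /zigzag /kappa tensr_comp tensl_comp !mcompA (comp_eq3 frobl).
rewrite !mcompA (comp_eq mu1l) -2!mcompA luiK compm1.
by rewrite -mcompA epsr ruiK.
Qed.

Lemma mate_kappa : mate kap gam = 'id.
Proof.
rewrite /mate /kappa tensr_comp tensl_comp !mcompA (comp_eq3 frobr).
rewrite !mcompA (comp_eq mu1r) -2!mcompA ruiK compm1.
by rewrite -mcompA epsl luiK.
Qed.

Lemma kappa_br : kap \oc br A A = kap.
Proof. by rewrite /kappa -mcompA comA. Qed.

(* The copairing is determined by the pairing, so this reduces to sliding both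
   kappa and the copairing through the braiding. *)
Lemma br_copairing : br A A \oc gam = gam.
Proof.
apply: (mate_inj kappa_zigzag); rewrite mate_kappa.
have H1 : (kap \ot 'id) \oc asci A A A \oc ('id \ot br A A) =
    lui A \oc ru A \oc ('id \ot kap) \oc asc A A A \oc (brinv A A \ot 'id) \oc asci A A A.
  have := br_nat (idm A) kap; rewrite hexagonr brX1 !mcompA => ->.
  rewrite -!mcompA.
  rewrite [asci A A A \oc (asc A A A \oc _)]mcompA ascK comp1m.
  by rewrite [(br A A \ot _) \oc (_ \oc _)]mcompA -tensl_comp brinvK tens11 comp1m asciK compm1.
have H2 : (brinv A A \ot 'id) \oc asci A A A \oc ('id \ot gam) =
    asci A A A \oc ('id \ot br A A) \oc asc A A A \oc (gam \ot 'id) \oc lui A \oc ru A.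
  have := br_nat gam (idm A); rewrite hexagonl br1X => H.
  have -> : 'id \ot gam = 'id \ot gam \oc (rui A \oc lu A) \oc (lui A \oc ru A).
    by rewrite !mcompA -[_ \oc lu A \oc _]mcompA luiK compm1 -mcompA ruK compm1.
  rewrite -H !mcompA.
  rewrite -[_ \oc asci A A A \oc asc A A A]mcompA ascK compm1 -tensl_comp brK tens11 comp1m.
  by [].
rewrite /mate tensr_comp !mcompA (comp_eq3 H1) !mcompA luiK comp1m (comp_eq3 H2) !mcompA.
rewrite -(mcompA (asci A A A) (asc A A A)) asciK compm1.
rewrite -(mcompA _ (idm A \ot kap)) -tensr_comp kappa_br.
by rewrite kappa_zigzag comp1m ruiK.
Qed.

Lemma Phi1_mate : Phi1 mu eps = mate kap (coev A).
Proof. by []. Qed.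

Definition Phi1_inv : Hom (dualo A) A := mate (ev A) gam.

Lemma Phi1_copairing : ('id \ot Phi1 mu eps) \oc gam = coev A.
Proof. exact: zigzag_mate kappa_zigzag. Qed.

Lemma Phi1_inv_coev : ('id \ot Phi1_inv) \oc coev A = gam.
Proof. exact: zigzag_mate (zigzag_ev_coev A). Qed.

Lemma Phi1K : Phi1_inv \oc Phi1 mu eps = 'id.
Proof. by rewrite Phi1_mate -mate_compr Phi1_inv_coev mate_kappa. Qed.

Lemma Phi1_invK : Phi1 mu eps \oc Phi1_inv = 'id.
Proof. by rewrite /Phi1_inv -mate_compr Phi1_copairing mate_ev_coev. Qed.

Lemma ev_Phi1 : ev A \oc (Phi1 mu eps \ot 'id) = kap.
Proof. exact: zigzag_mate_pairing (zigzag_ev_coev A). Qed.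

(** Transposing [kap \oc (f \ot 'id)] along the copairing gives back [f]. *)
Lemma kappa_nondegenerate (X : Ob C) (f g : Hom X A) :
  kap \oc (f \ot 'id) = kap \oc (g \ot 'id) -> f = g.
Proof. by move=> fg; rewrite -[f]comp1m -[g]comp1m -mate_kappa -!mate_compl fg. Qed.

(** Through [Phi1] the pairing becomes [ev A]. Naturality moves the twist to the dual of [A], where
    the ribbon axiom makes it the dual of [tw A], and evaluation passes it to the other leg. *)
Lemma kappa_tw : kap \oc (tw A \ot 'id) = kap \oc ('id \ot tw A).
Proof.
rewrite -ev_Phi1 -!mcompA -tensl_comp -tw_nat tw_dual tensl_comp mcompA ev_dualH.
by rewrite -mcompA -tens_splitr -tens_splitl.
Qed.

(** The twist of [tens A A] differs from [tw A \ot tw A] by a double braiding, which commutativity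
    absorbs. *)
Lemma tw_mu : tw A \oc mu = mu \oc (tw A \ot tw A).
Proof. by rewrite tw_nat tw_tens !mcompA !comA. Qed.

Lemma tw_eta : tw A \oc eta = eta.
Proof. by rewrite tw_nat tw1 compm1. Qed.

Lemma eps_tw : eps \oc tw A = eps.
Proof. by rewrite -tw_nat tw1 comp1m. Qed.

Lemma kappa_tw2 : kap \oc (tw A \ot tw A) = kap.
Proof. by rewrite /kappa -mcompA -tw_mu mcompA eps_tw. Qed.

(** The twist is both self-adjoint and an isometry for the nondegenerate pairing, so its square is
    the identity. *)
Lemma tw_involutive : tw A \oc tw A = 'id.
Proof.
apply: kappa_nondegenerate.
by rewrite tensl_comp mcompA kappa_tw -mcompA -tens_splitr kappa_tw2 tens11 compm1.
Qed.

Lemma tw_copairing : (tw A \ot tw A) \oc gam = gam.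
Proof.
apply: (mate_inj kappa_zigzag).
rewrite tens_splitr -mcompA mate_compr -mate_compm -kappa_tw mate_compl mate_kappa.
by rewrite comp1m tw_involutive.
Qed.

(** The coproduct is recovered from the product and the copairing, so its compatibility with the
    twist follows from theirs. *)
Lemma Delta_copairing : Delta = (mu \ot 'id) \oc asci A A A \oc ('id \ot gam) \oc rui A.
Proof. by rewrite tensr_comp mcompA frobr (comp_eq mu1r) -mcompA ruiK compm1. Qed.

Lemma Delta_tw : Delta \oc tw A = (tw A \ot tw A) \oc Delta.
Proof.
rewrite {2}Delta_copairing !mcompA tensM compm1 tw_mu.
have -> : (mu \oc (tw A \ot tw A)) \ot tw A = (mu \ot 'id) \oc ((tw A \ot tw A) \ot tw A).
  by rewrite tensM comp1m.
rewrite (comp_eq (esym (asci_nat _ _ _))) !mcompA (comp_eq (tensM _ _ _ _)) compm1.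
rewrite tw_copairing [tw A \ot gam]tens_splitr.
rewrite !mcompA -[_ \oc rui A]mcompA -rui_nat !mcompA.
by congr (_ \oc _); exact: Delta_copairing.
Qed.

(** The right coevaluation is the left one with a braiding and a twist; the copairing is symmetric
    and absorbs the braiding, so only the twist is left. *)
Lemma coevt_copairing : coevt A = (Phi1 mu eps \ot tw A) \oc gam.
Proof.
rewrite /coevt -Phi1_copairing mcompA -(mcompA _ (br _ _)) br_nat -!mcompA br_copairing.
by rewrite mcompA -tens_splitr.
Qed.

(** This is the identity of the Nakayama automorphism with the twist. The twist left in
    [coevt_copairing] crosses the pairing to the input strand, and the rest is [Phi1] after a
    snake. *)
Lemma Phi2_tw : Phi2 mu eps = Phi1 mu eps \oc tw A.
Proof.
rewrite /Phi2 coevt_copairing tensl_comp !mcompA (comp_eq (asc_nat _ _ _)) !mcompA.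
rewrite (comp_eq (tensM _ _ _ _)) comp1m kappa_tw.
have -> : Phi1 mu eps \ot (kap \oc ('id \ot tw A)) =
    (Phi1 mu eps \ot 'id) \oc ('id \ot kap) \oc ('id \ot ('id \ot tw A)).
  by rewrite !tensM comp1m !compm1.
rewrite !mcompA ru_nat (comp_eq (esym (asc_nat _ _ _))) tens11 !mcompA.
rewrite (comp_eq (esym (tens_splitr _ _))) (tens_splitl gam (tw A)) !mcompA.
rewrite (comp_eq (esym (lui_nat _))) !mcompA; congr (_ \oc _).
move: (Phi1 mu eps) => P; have := kappa_zigzag; rewrite /zigzag -!mcompA => ->; exact: compm1.
Qed.

Lemma symmetricP : is_symmetric mu eps <-> tw A = 'id.
Proof.
split=> [[g [gK [_ gP]]]|tw_id].
  by move: gP; rewrite Phi2_tw mcompA gK comp1m.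
exists Phi1_inv; rewrite Phi2_tw tw_id compm1.
by split; [exact: Phi1K | split; [exact: Phi1_invK | exact: Phi1K]].
Qed.

(** Writing [coev A] through [Phi1] turns the loop into the pairing closed by the copairing. The
    braiding in [evt] is absorbed by the symmetric pairing and its twist survives. *)
Lemma cdim_copairing : cdim A = kap \oc (tw A \ot 'id) \oc gam.
Proof.
rewrite /cdim /evt -Phi1_copairing !mcompA -(mcompA _ (tw A \ot _)) -tens_splitl tens_splitr.
by rewrite mcompA -(mcompA _ (br _ _)) br_nat mcompA ev_Phi1 kappa_br.
Qed.


(** * The twisted bubble and its vanishing *)

Definition twisted_bubble : Hom A A := mu \oc (tw A \ot 'id) \oc Delta.
Local Notation S := twisted_bubble.

(** This Frobenius relation sends the second factor into the untwisted leg, from which associativity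
    releases it unchanged. *)
Lemma twisted_bubble_mull : S \oc mu = mu \oc (S \ot 'id).
Proof.
rewrite /twisted_bubble -mcompA -frobl !mcompA (comp_eq (tensM _ _ _ _)) comp1m compm1.
rewrite [tw A \ot mu]tens_splitr mcompA -tens11 -(mcompA _ (tw A \ot _)) -asc_nat mcompA -muA.
by rewrite -!mcompA -!tensl_comp !mcompA.
Qed.

(** The other Frobenius relation sends the first factor into the twisted leg, so it comes out with a
    twist. *)
Lemma twisted_bubble_mulr : S \oc mu = mu \oc (tw A \ot S).
Proof.
rewrite /twisted_bubble -mcompA -frobr !mcompA (comp_eq (tensM _ _ _ _)) tw_mu comp1m.
have -> : (mu \oc (tw A \ot tw A)) \ot idm A =
    (mu \ot 'id) \oc ((tw A \ot tw A) \ot 'id) by rewrite tensM comp1m.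
rewrite mcompA muA (comp_eq (esym (asci_nat _ _ _))) !mcompA.
rewrite -(mcompA _ (asc _ _ _)) asciK compm1.
by rewrite -!mcompA !tensM !comp1m compm1 mcompA.
Qed.

Hypothesis haploidA : is_haploid A.

Lemma haploid_unit : eta != 0 -> forall f : Hom one_ob A, exists a : k, f = a *: eta.
Proof.
case: haploidA => v [_ v_gen] eta0 f.
have [a Ea] := v_gen eta; have [b ->] := v_gen f.
exists (b / a); rewrite Ea scalerA divfK //.
by apply: contraNneq eta0 => a0; rewrite Ea a0 scale0r.
Qed.

(** Haploidness makes [S \oc eta] a multiple [l] of [eta]. Inserting the unit in the first slot of
    [twisted_bubble_mull] gives the first formula, in the second slot of [twisted_bubble_mulr] the
    other. *)
Lemma twisted_bubble_scalar : eta != 0 ->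
  exists l : k, S = l *: 'id /\ S = l *: tw A.
Proof.
move=> eta0; have [l Sl] := haploid_unit eta0 (S \oc eta).
exists l; split.
  have -> : S = S \oc mu \oc (eta \ot 'id) \oc lui A.
    by rewrite (comp_eq mu1l) -mcompA luiK compm1.
  rewrite twisted_bubble_mull (comp_eq (tensM _ _ _ _)) compm1 Sl tensZl.
  by rewrite compZr compZl mu1l luiK.
have -> : S = S \oc mu \oc ('id \ot eta) \oc rui A.
  by rewrite (comp_eq mu1r) -mcompA ruiK compm1.
rewrite twisted_bubble_mulr (comp_eq (tensM _ _ _ _)) compm1 Sl tensZr.
by rewrite compZr compZl tens_splitr mcompA mu1r ru_nat -mcompA ruiK compm1.
Qed.

Lemma twisted_bubble0 : eta != 0 -> tw A != 'id -> S = 0.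
Proof.
move=> eta0 tw_nid; have [l [S1 S2]] := twisted_bubble_scalar eta0.
have : l *: ('id - tw A) = 0 :> Hom _ _ by rewrite scalerBr -S1 -S2 subrr.
move/eqP; rewrite scaler_eq0 subr_eq0 [_ == tw A]eq_sym (negPf tw_nid) orbF => /eqP l0.
by rewrite S1 l0 scale0r.
Qed.

Lemma cdim_twisted_bubble : cdim A = eps \oc S \oc eta.
Proof. by rewrite cdim_copairing /kappa /twisted_bubble !mcompA. Qed.

End CommutativeFrobenius.

(** * The eigenspaces of the twist: even part [B] and odd part [F] *)

Section EvenOddDecomposition.
Variables (k : fieldType) (C : ribbon_cat k).
Notation Hom := (Mor C).
Notation "''id'" := (idm _) (at level 0).
Variables (A : Ob C) (mu : Hom (tens A A) A) (eta : Hom one_ob A)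
  (Delta : Hom A (tens A A)) (eps : Hom A one_ob).
Hypothesis char2 : (2%:R : k) != 0.
Hypothesis frobA : is_frobenius_algebra mu eta Delta eps.
Hypothesis haploidA : is_haploid A.
Hypothesis comA : is_commutative mu.
Hypothesis separableA : is_Delta_separable mu Delta.
Hypothesis specialA : is_special mu eta Delta eps.

Let pp : Hom A A := (2%:R : k)^-1 *: (idm A + tw A).
Let pm : Hom A A := (2%:R : k)^-1 *: (idm A - tw A).
Let tw2 : tw A \oc tw A = 'id := tw_involutive frobA comA.

Lemma half_double (X Y : Ob C) (f : Hom X Y) : (2%:R : k)^-1 *: (f + f) = f.
Proof. by rewrite -mulr2n -scaler_nat scalerA mulVf // scale1r. Qed.

Lemma pp_even (X : Ob C) (f : Hom X A) : tw A \oc f = f -> pp \oc f = f.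
Proof. by move=> ff; rewrite /pp compZl compDl comp1m ff half_double. Qed.

Lemma pm_odd (X : Ob C) (f : Hom X A) : tw A \oc f = - f -> pm \oc f = f.
Proof. by move=> ff; rewrite /pm compZl compDl compNl comp1m ff opprK half_double. Qed.

Lemma tw_pp : tw A \oc pp = pp.
Proof. by rewrite /pp compZr compDr compm1 tw2 addrC. Qed.

Lemma tw_pm : tw A \oc pm = - pm.
Proof. by rewrite /pm compZr compDr compNr compm1 tw2 -scalerN opprB. Qed.

Lemma pp_idempotent : pp \oc pp = pp.
Proof. exact: pp_even tw_pp. Qed.

Lemma pm_idempotent : pm \oc pm = pm.
Proof. exact: pm_odd tw_pm. Qed.

(** As the twist is an involution, invariance under [tw A \ot tw A] lets a twist on one leg be
    traded for a twist on the other. *)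
Lemma tw_tens_even (X : Ob C) (u : Hom X (tens A A)) :
  (tw A \ot tw A) \oc u = u -> ('id \ot tw A) \oc u = (tw A \ot 'id) \oc u.
Proof. by move=> uu; rewrite -[in RHS]uu mcompA tensM tw2 comp1m. Qed.

Lemma tw_tens_odd (X : Ob C) (u : Hom X (tens A A)) :
  (tw A \ot tw A) \oc u = - u -> ('id \ot tw A) \oc u = - ((tw A \ot 'id) \oc u).
Proof. by move=> uu; rewrite -compNr -uu mcompA tensM tw2 comp1m. Qed.

Variables (B : Ob C) (iB : Hom B A) (pB : Hom A B).
Variables (F : Ob C) (iF : Hom F A) (pF : Hom A F).
Hypotheses (iBK : pB \oc iB = 'id) (pBK : iB \oc pB = pp).
Hypotheses (iFK : pF \oc iF = 'id) (pFK : iF \oc pF = pm).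

Variables (muB : Hom (tens B B) B) (etaB : Hom one_ob B)
  (DeltaB : Hom B (tens B B)) (epsB : Hom B one_ob) (rhoF : Hom (tens B F) F).
Hypotheses (muBE : muB = pB \oc mu \oc (iB \ot iB)) (etaBE : etaB = pB \oc eta)
  (DeltaBE : DeltaB = (pB \ot pB) \oc Delta \oc iB) (epsBE : epsB = eps \oc iB)
  (rhoFE : rhoF = pF \oc mu \oc (iB \ot iF)).

Let muA := frob_mulA frobA.
Let mu1l := frob_mul1l frobA.
Let mu1r := frob_mul1r frobA.
Let DeltaA := frob_comulA frobA.
Let epsl := frob_counitl frobA.
Let epsr := frob_counitr frobA.
Let frobl := frob_comul_mull frobA.
Let frobr := frob_comul_mulr frobA.

Lemma split_mono (X Y Z : Ob C) (i : Hom Y Z) (p : Hom Z Y) (f g : Hom X Y) :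
  p \oc i = 'id -> i \oc f = i \oc g -> f = g.
Proof. by move=> pi fg; rewrite -[f]comp1m -[g]comp1m -pi -!mcompA fg. Qed.

Lemma iB_mono (X : Ob C) (f g : Hom X B) : iB \oc f = iB \oc g -> f = g.
Proof. exact: split_mono iBK. Qed.

Lemma iF_mono (X : Ob C) (f g : Hom X F) : iF \oc f = iF \oc g -> f = g.
Proof. exact: split_mono iFK. Qed.

Lemma iBB_mono (X : Ob C) (f g : Hom X (tens B B)) :
  (iB \ot iB) \oc f = (iB \ot iB) \oc g -> f = g.
Proof. by apply: (@split_mono _ _ _ _ (pB \ot pB)); rewrite tensM iBK tens11. Qed.

Lemma iFF_mono (X : Ob C) (f g : Hom X (tens F F)) :
  (iF \ot iF) \oc f = (iF \ot iF) \oc g -> f = g.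
Proof. by apply: (@split_mono _ _ _ _ (pF \ot pF)); rewrite tensM iFK tens11. Qed.

Lemma tw_iB : tw A \oc iB = iB.
Proof. by rewrite -[iB]compm1 -iBK !mcompA -(mcompA _ iB) pBK tw_pp. Qed.

Lemma tw_iF : tw A \oc iF = - iF.
Proof. by rewrite -[iF]compm1 -iFK !mcompA -(mcompA _ iF) pFK tw_pm compNl. Qed.

Lemma tw_B : tw B = 'id.
Proof. by apply: iB_mono; rewrite -tw_nat tw_iB compm1. Qed.

Lemma tw_F : tw F = - 'id.
Proof. by apply: iF_mono; rewrite -tw_nat tw_iF compNr compm1. Qed.

Lemma iB_pB_even (X : Ob C) (f : Hom X A) : tw A \oc f = f -> iB \oc (pB \oc f) = f.
Proof. by rewrite mcompA pBK; exact: pp_even. Qed.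

Lemma iF_pF_odd (X : Ob C) (f : Hom X A) : tw A \oc f = - f -> iF \oc (pF \oc f) = f.
Proof. by rewrite mcompA pFK; exact: pm_odd. Qed.

Lemma iB_muB : iB \oc muB = mu \oc (iB \ot iB).
Proof.
by rewrite muBE -mcompA; apply: iB_pB_even; rewrite mcompA tw_mu // -mcompA tensM !tw_iB.
Qed.

Lemma iB_etaB : iB \oc etaB = eta.
Proof. by rewrite etaBE; apply: iB_pB_even; rewrite tw_eta. Qed.

Lemma iF_rhoF : iF \oc rhoF = mu \oc (iB \ot iF).
Proof.
rewrite rhoFE -mcompA; apply: iF_pF_odd.
by rewrite mcompA tw_mu // -mcompA tensM tw_iB tw_iF tensNr compNr.
Qed.

(** Associativity on generalised elements, ready for use with the inclusions of [B] and [F]. *)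
Lemma mu_tensA (X Y Z : Ob C) (x : Hom X A) (y : Hom Y A) (z : Hom Z A) :
  mu \oc ((mu \oc (x \ot y)) \ot z) = mu \oc (x \ot (mu \oc (y \ot z))) \oc asc X Y Z.
Proof.
have -> : (mu \oc (x \ot y)) \ot z = (mu \ot 'id) \oc ((x \ot y) \ot z).
  by rewrite tensM comp1m.
rewrite mcompA muA -mcompA asc_nat !mcompA.
by rewrite -(mcompA _ ('id \ot mu)) tensM comp1m.
Qed.

Lemma tw_Delta_iB : (tw A \ot tw A) \oc (Delta \oc iB) = Delta \oc iB.
Proof. by rewrite mcompA -(Delta_tw frobA comA) -mcompA tw_iB. Qed.

Lemma tw_Delta_iF : (tw A \ot tw A) \oc (Delta \oc iF) = - (Delta \oc iF).
Proof. by rewrite mcompA -(Delta_tw frobA comA) -mcompA tw_iF compNr. Qed.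

Lemma pp_tens_even (X : Ob C) (u : Hom X (tens A A)) :
  (tw A \ot tw A) \oc u = u -> ('id \ot pp) \oc u = (pp \ot 'id) \oc u.
Proof.
by move=> /tw_tens_even H; rewrite /pp tensZr tensZl !compZl tensDl tensDr !compDl H.
Qed.

Lemma pm_tens_even (X : Ob C) (u : Hom X (tens A A)) :
  (tw A \ot tw A) \oc u = u -> ('id \ot pm) \oc u = (pm \ot 'id) \oc u.
Proof.
move=> /tw_tens_even H.
by rewrite /pm tensZr tensZl !compZl tensDl tensDr !compDl tensNl tensNr !compNl H.
Qed.

(** An odd element has one even and one odd leg, so its second leg is odd exactly where its first
    leg is even. *)
Lemma pp_pm_tens_odd (X : Ob C) (u : Hom X (tens A A)) :
  (tw A \ot tw A) \oc u = - u -> ('id \ot pm) \oc u = (pp \ot 'id) \oc u.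
Proof.
move=> /tw_tens_odd H.
by rewrite /pm /pp tensZr tensZl !compZl tensDl tensDr !compDl tensNr !compNl H opprK.
Qed.

(** On [B] the coproduct is even, so its legs have equal parity and projecting one of them projects
    both. The choice of leg is free, which the proof of [frobeniusB] exploits. *)
Lemma iB_DeltaB_l : (iB \ot iB) \oc DeltaB = (pp \ot 'id) \oc (Delta \oc iB).
Proof.
rewrite DeltaBE !mcompA tensM pBK -mcompA [pp \ot pp]tens_splitl -mcompA.
by rewrite pp_tens_even ?tw_Delta_iB // mcompA tensM pp_idempotent comp1m mcompA.
Qed.

Lemma iB_DeltaB_r : (iB \ot iB) \oc DeltaB = ('id \ot pp) \oc (Delta \oc iB).
Proof. by rewrite iB_DeltaB_l pp_tens_even ?tw_Delta_iB. Qed.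

(** Each axiom is tested after a split inclusion, where it becomes the axiom of [A] up to
    projections. The product is simply restricted, but the coproduct loses its odd-odd component;
    its projection is put on a leg that the next operation does not meet. *)
Lemma frobeniusB : is_frobenius_algebra muB etaB DeltaB epsB.
Proof.
split; [|split; [|split; [|split; [|split; [|split; [|split]]]]]].
- apply: iB_mono; rewrite !mcompA iB_muB -(mcompA (muB \ot 'id)) -(mcompA ('id \ot muB)).
  by rewrite !tensM !compm1 iB_muB mu_tensA.
- apply: iB_mono; rewrite mcompA iB_muB -mcompA tensM iB_etaB compm1 tens_splitl.
  by rewrite mcompA mu1l lu_nat.
- apply: iB_mono; rewrite mcompA iB_muB -mcompA tensM iB_etaB compm1 tens_splitr.
  by rewrite mcompA mu1r ru_nat.
- apply: (@split_mono _ _ _ (iB \ot (iB \ot iB)) (pB \ot (pB \ot pB))).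
    by rewrite !tensM iBK !tens11.
  (* Both iterated coproducts of [B] are that of [A] with the two outer legs projected. *)
  transitivity ((pp \ot ('id \ot pp)) \oc (asc A A A \oc (Delta \ot 'id) \oc Delta) \oc iB).
    have E : (iB \ot iB \ot iB) \oc (DeltaB \ot 'id) =
        ((pp \ot 'id) \oc Delta) \ot 'id \oc (iB \ot iB).
      by rewrite !tensM iB_DeltaB_l compm1 comp1m !mcompA.
    rewrite !mcompA -asc_nat -(mcompA _ _ (asc _ _ _)) E.
    rewrite -!mcompA iB_DeltaB_r !mcompA -asc_nat; congr (_ \oc _ \oc _).
    by rewrite -!mcompA !tensM !comp1m !compm1.
  have E : (iB \ot (iB \ot iB)) \oc ('id \ot DeltaB) =
      'id \ot (('id \ot pp) \oc Delta) \oc (iB \ot iB).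
    by rewrite !tensM iB_DeltaB_r compm1 comp1m !mcompA.
  rewrite DeltaA [in RHS]mcompA E -[RHS]mcompA iB_DeltaB_l !mcompA; congr (_ \oc _ \oc _).
  by rewrite !tensM !comp1m !compm1.
- apply: (@split_mono _ _ _ ('id \ot iB) ('id \ot pB)).
    by rewrite tensM iBK comp1m tens11.
  rewrite -lui_nat mcompA tensM comp1m compm1 epsBE.
  have -> : (eps \oc iB) \ot iB = (eps \ot 'id) \oc (iB \ot iB) by rewrite tensM comp1m.
  (* The projection goes on the leg that [eps] does not touch, so the counit law of [A] applies. *)
  rewrite -mcompA iB_DeltaB_r !mcompA tensM comp1m compm1 tens_splitr.
  by rewrite -(mcompA Delta) epsl -lui_nat -mcompA pp_even ?tw_iB.
- apply: (@split_mono _ _ _ (iB \ot 'id) (pB \ot 'id)).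
    by rewrite tensM iBK comp1m tens11.
  rewrite -rui_nat mcompA tensM comp1m compm1 epsBE.
  have -> : iB \ot (eps \oc iB) = ('id \ot eps) \oc (iB \ot iB) by rewrite tensM comp1m.
  rewrite -mcompA iB_DeltaB_l !mcompA tensM comp1m compm1 tens_splitl.
  by rewrite -(mcompA Delta) epsr -rui_nat -mcompA pp_even ?tw_iB.
- apply: iBB_mono; rewrite !mcompA iB_DeltaB_l tensM iB_muB compm1.
  have -> : iB \ot (mu \oc (iB \ot iB)) = ('id \ot mu) \oc (iB \ot (iB \ot iB)).
    by rewrite tensM comp1m.
  rewrite (comp_eq (esym (asc_nat _ _ _))) !mcompA (comp_eq (tensM _ _ _ _)) iB_DeltaB_l compm1.
  have -> : (pp \ot 'id \oc (Delta \oc iB)) \ot iB =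
      ((pp \ot 'id) \ot 'id) \oc ((Delta \ot 'id) \oc (iB \ot iB)).
    by rewrite !tensM !comp1m.
  rewrite !mcompA (comp_eq (asc_nat _ _ _)) !mcompA tens11 tensM comp1m compm1 tens_splitl.
  by rewrite -(mcompA _ _ (pp \ot _)) -(mcompA _ _ (pp \ot _)) frobl -!mcompA iB_muB.
- apply: iBB_mono; rewrite !mcompA iB_DeltaB_r tensM iB_muB compm1.
  have -> : (mu \oc (iB \ot iB)) \ot iB = (mu \ot 'id) \oc ((iB \ot iB) \ot iB).
    by rewrite tensM comp1m.
  rewrite (comp_eq (esym (asci_nat _ _ _))) !mcompA (comp_eq (tensM _ _ _ _)) iB_DeltaB_r compm1.
  have -> : iB \ot ('id \ot pp \oc (Delta \oc iB)) =
      ('id \ot ('id \ot pp)) \oc (('id \ot Delta) \oc (iB \ot iB)).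
    by rewrite !tensM !comp1m.
  rewrite !mcompA (comp_eq (asci_nat _ _ _)) !mcompA tens11 tensM comp1m compm1 tens_splitr.
  by rewrite -(mcompA _ _ ('id \ot pp)) -(mcompA _ _ ('id \ot pp)) frobr -!mcompA iB_muB.
Qed.

Lemma commutativeB : is_commutative muB.
Proof. by apply: iB_mono; rewrite mcompA iB_muB -mcompA -br_nat mcompA comA. Qed.

Lemma symmetricB : is_symmetric muB epsB.
Proof. exact/(symmetricP frobeniusB commutativeB)/tw_B. Qed.

Lemma unit_neq0 : eta != 0.
Proof.
case: specialA => [[a [a0 Ea]] _]; apply: contraNneq a0 => eta0.
case: (rc_axioms C) => [_ [_ [_ [_ [_ [_ [_ [id0 _]]]]]]]].
move/eqP: Ea; rewrite eta0 comp0r eq_sym scaler_eq0 => /orP[//|].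
by rewrite (negPf id0).
Qed.

(** Composition with [iB] embeds the morphisms from the unit object to [B] into the line spanned by
    [eta], and [eta] itself factors through [B]. *)
Lemma haploidB : is_haploid B.
Proof.
exists etaB; split.
  by apply: contraNneq unit_neq0 => eta0; rewrite -iB_etaB eta0 comp0r.
move=> f; have [a fa] := haploid_unit haploidA unit_neq0 (iB \oc f).
by exists a; apply: iB_mono; rewrite fa compZr iB_etaB.
Qed.

(** * The non-symmetric case: speciality of [B] and the local module [F] *)

Hypothesis tw_neq1 : tw A != 'id.

Let bubble0 : mu \oc (tw A \ot 'id) \oc Delta = 0.
Proof. exact: (twisted_bubble0 frobA comA haploidA unit_neq0 tw_neq1). Qed.

Lemma mu_pp_Delta : mu \oc (pp \ot 'id) \oc Delta = 2%:R^-1 *: 'id.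
Proof.
rewrite /pp tensZl tensDl tens11 compZr compZl compDr compDl bubble0 compm1.
by rewrite separableA addr0.
Qed.

Lemma mu_pm_Delta : mu \oc (pm \ot 'id) \oc Delta = 2%:R^-1 *: 'id.
Proof.
rewrite /pm tensZl tensDl tensNl tens11 compZr compZl compDr compNr compDl compNl bubble0 compm1.
by rewrite separableA subr0.
Qed.

Lemma specialB : is_special muB etaB DeltaB epsB.
Proof.
split.
  case: specialA => [[a [a0 Ea]] _]; exists a; split => //.
  by rewrite epsBE -mcompA iB_etaB.
(* Only the even half of the bubble [mu \oc Delta] survives in [B]. *)
exists 2%:R^-1; split; first by rewrite invr_neq0.
apply: iB_mono; rewrite mcompA iB_muB -mcompA iB_DeltaB_l !mcompA mu_pp_Delta.
by rewrite compZl compZr comp1m compm1.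
Qed.

Lemma left_moduleF : is_left_module muB etaB rhoF.
Proof.
split; apply: iF_mono.
  rewrite !mcompA iF_rhoF -(mcompA (muB \ot 'id)) -(mcompA ('id \ot rhoF)).
  by rewrite !tensM !compm1 iB_muB iF_rhoF mu_tensA.
rewrite mcompA iF_rhoF -mcompA tensM iB_etaB compm1 tens_splitl.
by rewrite mcompA mu1l lu_nat.
Qed.

(** The action is a restriction of the commutative product, which absorbs each of the two
    braidings. *)
Lemma localF : is_local rhoF.
Proof.
apply: iF_mono; rewrite !mcompA iF_rhoF -(mcompA _ (iB \ot iF)) -br_nat.
by rewrite -!mcompA -br_nat !mcompA !comA.
Qed.

(** * The tensor square of [F] over [B] *)

Variables (q : Hom (tens F F) B) (s : Hom B (tens F F)).
Hypotheses (qE : q = pB \oc mu \oc (iF \ot iF))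
  (sE : s = 2%:R *: ((pF \ot pF) \oc (Delta \oc iB))).

Lemma iB_even_product : iB \oc q = mu \oc (iF \ot iF).
Proof.
rewrite qE -mcompA; apply: iB_pB_even.
by rewrite mcompA tw_mu // -mcompA tensM tw_iF tensNl tensNr opprK.
Qed.

Lemma iF_even_section : (iF \ot iF) \oc s = 2%:R *: (('id \ot pm) \oc (Delta \oc iB)).
Proof.
rewrite sE compZr mcompA tensM pFK tens_splitr -mcompA.
by rewrite -pm_tens_even ?tw_Delta_iB // mcompA tensM pm_idempotent comp1m.
Qed.

(** The factor 2 in [s] cancels the value 1/2 of the odd bubble [mu_pm_Delta]. *)
Lemma even_productK : q \oc s = 'id.
Proof.
apply: iB_mono; rewrite mcompA iB_even_product -mcompA iF_even_section.
rewrite pm_tens_even ?tw_Delta_iB // compZr !mcompA mu_pm_Delta compZl scalerA.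
by rewrite divff // scale1r comp1m compm1.
Qed.

(** Inside [A] both sides are the same triple product, by associativity and commutativity. *)
Lemma even_product_balanced :
  q \oc tensB_map1 F rhoF = q \oc tensB_map2 F rhoF.
Proof.
apply: iB_mono; rewrite /tensB_map1 /tensB_map2 !mcompA iB_even_product.
rewrite -(mcompA (rhoF \ot 'id)) -(mcompA ('id \ot rhoF)) !tensM !compm1 iF_rhoF.
by rewrite -mu_tensA -[RHS]mcompA tensM compm1 -(mcompA (br B F)) -br_nat mcompA comA.
Qed.

Lemma rhoF_Delta_iF : rhoF \oc ((pB \ot pF) \oc (Delta \oc iF)) = 2%:R^-1 *: 'id.
Proof.
apply: iF_mono; rewrite mcompA iF_rhoF -mcompA [(iB \ot iF) \oc _]mcompA tensM pBK pFK.
rewrite tens_splitl -mcompA pp_pm_tens_odd ?tw_Delta_iF // [(pp \ot _) \oc _]mcompA tensM.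
rewrite pp_idempotent comp1m !mcompA mu_pp_Delta.
by rewrite compZl compZr comp1m compm1.
Qed.

(* The right action of B on F is the left action precomposed with the inverse braiding. *)
Lemma even_section_product :
  s \oc q = 2%:R *: (((rhoF \oc brinv B F) \ot 'id) \oc asci F B F
                       \oc ('id \ot ((pB \ot pF) \oc (Delta \oc iF)))).
Proof.
apply: iFF_mono; rewrite mcompA iF_even_section compZl compZr; congr (_ *: _).
have Eact : iF \oc (rhoF \oc brinv B F) = mu \oc (iF \ot iB).
  rewrite mcompA iF_rhoF -{1}comA -(mcompA _ (br _ _)) br_nat -!mcompA brinvK.
  by rewrite compm1.
rewrite [RHS]mcompA [(iF \ot iF) \oc (_ \oc _)]mcompA tensM Eact compm1.
have -> : (mu \oc (iF \ot iB)) \ot iF = (mu \ot 'id) \oc ((iF \ot iB) \ot iF).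
  by rewrite tensM comp1m.
rewrite (comp_eq (esym (asci_nat _ _ _))) !mcompA (comp_eq (tensM _ _ _ _)) compm1.
rewrite -(mcompA iF Delta) [(iB \ot iF) \oc (_ \oc _)]mcompA tensM pBK pFK.
(* The coproduct is odd on [F], so an odd second leg already forces an even first leg; the first leg
   is then free for the Frobenius relation. *)
have -> : (pp \ot pm) \oc (Delta \oc iF) = ('id \ot pm) \oc (Delta \oc iF).
  rewrite tens_splitl -mcompA pp_pm_tens_odd ?tw_Delta_iF // [LHS]mcompA tensM.
  by rewrite pp_idempotent comp1m.
have -> : iF \ot ('id \ot pm \oc (Delta \oc iF)) =
    ('id \ot ('id \ot pm)) \oc (('id \ot Delta) \oc (iF \ot iF)).
  by rewrite !tensM !comp1m.
rewrite !mcompA (comp_eq (asci_nat _ _ _)) !mcompA tens11 tensM comp1m compm1 [mu \ot pm]tens_splitr.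
rewrite (comp_eq3 frobr).
by rewrite -!mcompA iB_even_product.
Qed.

(** A balanced [g] must factor through [q] as [g \oc s]. By [even_section_product], [s \oc q] splits
    the second factor into a [B] part and an [F] part and lets the former act on the first factor;
    balancing returns it to the second. *)
Lemma even_product_coequaliser :
  is_coequaliser (tensB_map1 F rhoF) (tensB_map2 F rhoF) q.
Proof.
split=> [|Z g gE]; first exact: even_product_balanced.
exists (g \oc s); split=> [|h <-]; last by rewrite -mcompA even_productK compm1.
rewrite -mcompA even_section_product compZr tensl_comp !mcompA.
move: gE; rewrite /tensB_map1 /tensB_map2 => ->.
rewrite !mcompA -(mcompA _ (br B F \ot 'id)) -tensl_comp brinvK tens11 compm1.
rewrite -(mcompA (asci _ _ _) (asc _ _ _)) asciK compm1 -(mcompA iF Delta).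
(* Acting with the [B] part on the [F] part of the same coproduct gives 1/2, which the factor 2 of
   [s] cancels. *)
rewrite -mcompA -tensr_comp rhoF_Delta_iF.
by rewrite tensZr tens11 compZr compm1 scalerA divff // scale1r.
Qed.

Lemma tensor_squareF : is_tensor_over rhoF rhoF B.
Proof.
exists B, q; split; first exact: even_product_coequaliser.
by exists 'id; exists 'id; rewrite comp1m.
Qed.

End EvenOddDecomposition.

(** * The symmetric and non-symmetric cases together *)

Theorem mainTheorem3 (k : fieldType) (C : ribbon_cat k) (char2 : (2%:R : k) != 0)
  (A : Ob C) (mu : Mor C (tens A A) A) (eta : Mor C one_ob A)
  (Delta : Mor C A (tens A A)) (eps : Mor C A one_ob) :
  is_frobenius_algebra mu eta Delta eps ->
  is_haploid A ->
  is_commutative mu ->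
  is_Delta_separable mu Delta ->
  is_special mu eta Delta eps ->
  (* (1) *)
  (is_symmetric mu eps -> cdim A = eps \oc eta /\ eps \oc eta != 0) /\
  (* (2) and the decomposition *)
  (~ is_symmetric mu eps ->
     cdim A = 0 /\
     let pp : Mor C A A := (2%:R : k)^-1 *: (idm A + tw A) in
     let pm : Mor C A A := (2%:R : k)^-1 *: (idm A - tw A) in
     pp \oc pp = pp /\ pm \oc pm = pm /\
     forall (B : Ob C) (iB : Mor C B A) (pB : Mor C A B)
            (F : Ob C) (iF : Mor C F A) (pF : Mor C A F),
       pB \oc iB = idm B -> iB \oc pB = pp ->
       pF \oc iF = idm F -> iF \oc pF = pm ->
       let muB := pB \oc mu \oc (iB \ot iB) in
       let etaB := pB \oc eta in
       let DeltaB := (pB \ot pB) \oc Delta \oc iB in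
       let epsB := eps \oc iB in
       let rhoF := pF \oc mu \oc (iB \ot iF) in
       ((is_frobenius_algebra muB etaB DeltaB epsB) /\ (is_haploid B) /\ (is_symmetric muB epsB) /\ (is_commutative muB) /\ (is_special muB etaB DeltaB epsB) /\ (is_left_module muB etaB rhoF /\ is_local rhoF) /\ (tw F = - idm F) /\ (is_tensor_over rhoF rhoF B))).
Proof.
move=> frobA haploidA comA sepA specA.
have eta0 := unit_neq0 specA.
split=> [/(symmetricP frobA comA) tw_id|nsym].
  (* With trivial twist the bubble is [mu \oc Delta], the identity by separability, so the dimension
     is [eps \oc eta]. *)
  rewrite (cdim_twisted_bubble frobA comA) /twisted_bubble tw_id tens11 compm1 sepA compm1; split=> //.
  case: specA => [[a [a0 ->]] _]; rewrite scaler_eq0 negb_or a0.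
  by case: (rc_axioms C) => [_ [_ [_ [_ [_ [_ [_ [id0 _]]]]]]]].
have tw_neq1 : tw A != idm A.
  by apply/eqP => tw_id; apply: nsym; exact/(symmetricP frobA comA).
split.
  by rewrite (cdim_twisted_bubble frobA comA) (twisted_bubble0 frobA comA haploidA eta0 tw_neq1) comp0r comp0l.
split; first exact: (pp_idempotent char2 frobA comA).
split; first exact: (pm_idempotent char2 frobA comA).
move=> B iB pB F iF pF iBK pBK iFK pFK muB etaB DeltaB epsB rhoF.
split; first by apply: (frobeniusB char2 frobA comA iBK pBK).
split; first by apply: (haploidB char2 haploidA specA iBK pBK).
split; first by apply: (symmetricB char2 frobA comA iBK pBK).
split; first by apply: (commutativeB char2 frobA comA iBK pBK).
split; first by apply: (specialB char2 frobA haploidA comA sepA specA iBK pBK).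
split; first split.
- by apply: (left_moduleF char2 frobA comA iBK pBK iFK pFK).
- by apply: (localF char2 frobA comA iBK pBK iFK pFK).
split; first exact: (tw_F frobA comA iFK pFK).
by apply: (tensor_squareF char2 frobA haploidA comA sepA specA iBK pBK iFK pFK).
Qed.
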